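(* Let $Q$ be a natural join query with hypergraph $\mathcal H=(\mathcal V,\mathcal E)$, with fractional hypertree width $\mathrm{fhtw}$ and fractional edge cover number $\rho^*$; for a database instance $I$ for $Q$ let $N$ be the size of its largest relation and $D=Q(I)$. Let $h_1,\dots,h_m$ be feature functions with categorical variable sets $C_1,\dots,C_m\subseteq\mathcal V$, and for $i,j\in[m]$ let $\boldsymbol\sigma_{ij}=\frac1{|D|}\sum_{(\mathbf x,y)\in D}h_i(\mathbf x)\otimes h_j(\mathbf x)$. Let $c=\max_{i,j}|C_i\cup C_j|$ be the maximum number of categorical variables for any $\boldsymbol\sigma_{ij}$, and assume $c\ge1$. Then for all $i,j\in[m]$ $$\mathrm{faqw}(i,j)\le\mathrm{fhtw}+c-1\qquad\text{and}\qquad|\boldsymbol\sigma_{ij}|\le N^{\min\{\rho^*,c\}} .$$ Moreover, for any query $Q$ with $\rho^*>\mathrm{fhtw}+c-1$ there are infinitely many database instances (with $N\to\infty$) for which $$\lim_{N\to\infty}\frac{N^{\rho^*}}{\sum_{i,j\in[m]}\big(N^{\mathrm{faqw}(i,j)}+N^{\min\{\rho^*,c\}}\big)\log N}=\infty .$$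
   Context: Query: $\mathcal V$ is the set of variables of $Q$, $\mathcal E$ has one hyperedge per relation of $Q$ (its set of variables); $D=Q(I)$ is the set of tuples over $\mathcal V$ whose projection on each hyperedge lies in the corresponding relation. $V\subseteq\mathcal V$ is the set of features and $C\subseteq V$ the categorical ones. For a tuple of $D$, $\mathbf x=(\mathbf x_f)_{f\in V}$, with $\mathbf x_f$ a real number $x_f$ if $f$ is continuous and the one-hot indicator vector of the $f$-value over the active domain of $f$ if $f$ is categorical; $y$ is the response value. Feature functions: $h_j(\mathbf x)=\prod_{f\in V_j\setminus C_j}x_f^{a_j(f)}\cdot\bigotimes_{f\in C_j}\mathbf x_f$, with $a_j\in\mathbb N^V$, $V_j=\{f:a_j(f)>0\}$, $C_j=C\cap V_j$. $|\boldsymbol\sigma_{ij}|$ is the number of tuples in its sparse representation, i.e. the relation listing the combinations of values of the variables $C_i\cup C_j$ occurring in $D$ together with the tensor value. Widths: for $B\subseteq\mathcal V$, $\rho^*_{\mathcal H}(B)$ is the minimum of $\sum_{S\in\mathcal E}\lambda_S$ over $\lambda_S\ge0$ with $\sum_{S\ni v}\lambda_S\ge1$ for all $v\in B$; $\rho^*=\rho^*_{\mathcal H}(\mathcal V)$. $\mathrm{fhtw}$ is the minimum over all tree decompositions of $\mathcal H$ of the maximum of $\rho^*_{\mathcal H}$ over its bags. For an ordering $\sigma=(v_1,\dots,v_\nu)$ of $\mathcal V$, the elimination sets are: $U_\nu^\sigma$ is the union of all hyperedges containing $v_\nu$; then $v_\nu$ and all hyperedges containing it are removed, the hyperedge $U_\nu^\sigma\setminus\{v_\nu\}$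 is added, and $U^\sigma_{\nu-1},\dots,U_1^\sigma$ are defined recursively on the resulting hypergraph. $\mathrm{faqw}(\sigma)=\max_j\rho^*_{\mathcal H}(U_j^\sigma)$ (with $\rho^*$ in the original hypergraph), and $\mathrm{faqw}(i,j)$ is the minimum of $\mathrm{faqw}(\sigma)$ over all orderings $\sigma$ that list all variables of $C_i\cup C_j$ before all other variables. *)

(* Defs.v *)
From HB Require Import structures.
From mathcomp Require Import all_boot all_order all_algebra finmap.
From mathcomp Require Import all_classical all_reals all_analysis.
Set Implicit Arguments.
Unset Strict Implicit.
Unset Printing Implicit Defensive.
Import Order.TTheory GRing.Theory Num.Theory.
Import numFieldNormedType.Exports.
Local Open Scope classical_set_scope.
Local Open Scope ring_scope.

(* The hyperedges are indexed by the relation symbols, so two relations may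
   have the same set of variables.  The variables of a query are by definition
   those of its relations. *)
Record query := Query {
  vars : finType;
  rels : finType;
  schema : rels -> {set vars};
  schema_cover : forall v : vars, exists r : rels, v \in schema r }.

Section Widths.
Variables (R : realType) (Q : query).

Definition fractional_cover (B : {set vars Q}) (w : rels Q -> R) : Prop :=
  (forall r, 0 <= w r) /\
  (forall v, v \in B -> 1 <= \sum_(r : rels Q | v \in schema r) w r).

(* In [rho], [fhtw] and [faqw] the infimum is over a nonempty set of
   nonnegative reals and is attained, so it is the minimum. *)
Definition rho (B : {set vars Q}) : R :=
  inf [set \sum_(r : rels Q) w r | w in [set w | fractional_cover B w]].

Definition rhostar : R := rho [set: vars Q]%SET.

Record tree_decomp := TreeDecomp {
  node : finType;
  tedge : rel node;
  bag : node -> {set vars Q};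
  node_nonempty : (0 < #|node|)%N;
  tedge_sym : symmetric tedge;
  tedge_irr : irreflexive tedge;
  tedge_connected : forall s t, connect tedge s t;
  tedge_acyclic : forall p : seq node, (2 < size p)%N -> ~~ ucycleb tedge p;
  bag_cover : forall r : rels Q, exists t, schema r \subset bag t;
  bag_connected : forall (v : vars Q) (s t : node), v \in bag s -> v \in bag t ->
    connect [rel x y | [&& tedge x y, v \in bag x & v \in bag y]] s t }.

Definition td_width (T : tree_decomp) : R :=
  \big[Num.max/0]_(t : node T) rho (bag t).

Definition fhtw : R := inf [set x | exists T : tree_decomp, x = td_width T].

(* [s] lists the vertices in order of elimination, i.e. it is the reverse of
   the variable ordering (v_1, ..., v_nu); the result is U_nu, ..., U_1. *)
Fixpoint elim_sets (E : {set {set vars Q}}) (s : seq (vars Q)) :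
    seq {set vars Q} :=
  if s is v :: s' then
    let U := (\bigcup_(S in E | v \in S) S)%SET in
    U :: elim_sets ((U :\ v) |: [set S in E | v \notin S])%SET s'
  else [::].

Definition hyperedges : {set {set vars Q}} :=
  [set schema r | r : rels Q]%SET.

Definition faqw_ord (s : seq (vars Q)) : R :=
  \big[Num.max/0]_(U <- elim_sets hyperedges (rev s)) rho U.

Definition ordering_first (F : {set vars Q}) (s : seq (vars Q)) : Prop :=
  perm_eq s (enum (vars Q)) /\
  (forall u v, u \in F -> v \notin F -> (index u s < index v s)%N).

Definition faqw (F : {set vars Q}) : R :=
  inf [set faqw_ord s | s in [set s | ordering_first F s]].

End Widths.

Record features (Q : query) := Features {
  feat : {set vars Q};
  cat : {set vars Q};
  cat_feat : cat \subset feat }.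

Section Databases.
(* A data value is a real number or a label from an arbitrary type [L]. *)
Variables (R : realType) (L : choiceType) (Q : query) (F : features Q).

Definition value := (R + L)%type.

Definition tup (S : {set vars Q}) := {ffun {v : vars Q | v \in S} -> value}.

Definition full_tuple := {ffun vars Q -> value}.

Definition proj (S : {set vars Q}) (t : full_tuple) : tup S :=
  [ffun v : {v : vars Q | v \in S} => t (val v)].

(* Continuous features take real values; other variables are unconstrained. *)
Record instance := Instance {
  relation : forall r : rels Q, {fset tup (schema r)};
  continuous_real : forall (r : rels Q) (t : tup (schema r))
      (v : {v : vars Q | v \in schema r}),
    t \in relation r -> val v \in feat F :\: cat F -> exists x : R, t v = inl x }.

Definition instance_size (I : instance) : nat :=
  \max_(r : rels Q) #|` relation I r|.

Definition join (I : instance) : set full_tuple :=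
  [set t | forall r : rels Q, proj (schema r) t \in relation I r].

(* The default value is never used on continuous features of tuples of the
   join. *)
Definition real_of (u : value) : R := if u is inl x then x else 0.

(* Coordinates of [one_hot u] outside the active domain are zero, so indexing
   by all values amounts to indexing by the active domain. *)
Definition one_hot (u : value) : value -> R := fun w => (w == u)%:R.

(* A feature function is given by its exponents [a]. *)
Definition fvars (a : vars Q -> nat) : {set vars Q} :=
  [set f in feat F | (0 < a f)%N]%SET.

Definition cvars (a : vars Q -> nat) : {set vars Q} := (cat F :&: fvars a)%SET.

(* Tensors over a set [S] of categorical variables are indexed by [tup S]. *)
Definition hfun (a : vars Q -> nat) (t : full_tuple) (k : tup (cvars a)) : R :=
  (\prod_(f in fvars a :\: cvars a) real_of (t f) ^+ a f) *
  \prod_(f : {f : vars Q | f \in cvars a}) one_hot (t (val f)) (k f).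

Definition sigma (I : instance) (a b : vars Q -> nat)
    (k : tup (cvars a)) (l : tup (cvars b)) : R :=
  (#|` fset_set (join I)|%:R)^-1 *
  \sum_(t \in join I) (hfun t k * hfun t l).

Definition sigma_sparse (I : instance) (a b : vars Q -> nat) :
    set (tup (cvars a :|: cvars b) * R) :=
  [set (proj (cvars a :|: cvars b) t, sigma I (proj (cvars a) t) (proj (cvars b) t))
    | t in join I].

Definition sigma_size (I : instance) (a b : vars Q -> nat) : nat :=
  #|` fset_set (@sigma_sparse I a b)|.

Definition max_cat (m : nat) (a : 'I_m -> vars Q -> nat) : nat :=
  \max_(i < m) \max_(j < m) #|cvars (a i) :|: cvars (a j)|.

End Databases.

(* Main.v *)
(* Elimination width.  Fix a tree decomposition, a variable v0 of F lying in
   some bag r, and put K = F \ {v0}.  Repeatedly take a leaf of the tree other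
   than r: either some variable outside F occurs only in the leaf bag, and
   eliminating it creates an elimination set inside that bag together with K, or
   the leaf bag is, up to K, contained in the neighbouring bag and the leaf can
   be pruned.  The order obtained eliminates F last and has width at most the
   width of the decomposition plus |K|.

   Sparse size.  The number of entries is at most the number of projections of
   the join on the categorical variables B.  By the fractional cover bound of
   Atserias, Grohe and Marx, applied to B instead of to all variables, it is at
   most N^rho(B), and rho(B) is bounded by both rhostar and |B|.

   Gap.  The quotient depends on the instance only through N, and
   c <= fhtw + c - 1 because fhtw >= 1, so every exponent in the denominator is
   at most fhtw + c - 1 < rhostar: any instances of unbounded size do. *)
Require Import Defs.
From mathcomp Require Import all_boot all_order all_algebra finmap.
From mathcomp Require Import all_classical all_reals all_analysis.
From mathcomp Require Import ring lra.
Set Implicit Arguments.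
Unset Strict Implicit.
Unset Printing Implicit Defensive.
Import Order.TTheory GRing.Theory Num.Theory.
Import numFieldNormedType.Exports.
Local Open Scope classical_set_scope.
Local Open Scope ring_scope.

(** * Leaves of finite trees and retraction of walks *)

Section Trees.
Variables (T : finType) (e : rel T).
Hypothesis e_irr : irreflexive e.
Hypothesis e_acyclic : forall p : seq T, (2 < size p)%N -> ~~ ucycleb e p.

(* [l] is the end of a longest simple path from [r] inside [X]. *)
Lemma tree_leaf (X : {set T}) (r : T) :
  r \in X -> X != [set r]%SET ->
  {in X, forall x, connect [rel x y | [&& e x y, x \in X & y \in X]] r x} ->
  exists l p, [/\ l \in X, p \in X, l != r, p != l &
    forall y, y \in X -> e l y -> y = p].
Proof.
move=> rX Xr Xconn.
pose eX := [rel x y | [&& e x y, x \in X & y \in X]].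
pose P n := [exists q : n.-tuple T, path eX r q && uniq (r :: q)].
have exP : exists n, P n by exists 0%N; apply/existsP; exists [tuple].
have Pmax n : P n -> (n <= #|T|)%N.
  case/existsP=> q /andP[_ /card_uniqP /= cq].
  have := max_card (mem (r :: q)); rewrite cq /= size_tuple => /ltnW //.
case: (ex_maxnP exP Pmax) => n /existsP[q /andP[qp qu]] nmax.
have qext y : ~~ (path eX r (rcons q y) && uniq (r :: rcons q y)).
  apply/negP => qy; have /nmax : P n.+1.
    by apply/existsP; exists [tuple of rcons q y].
  by rewrite ltnn.
have [y0 ry0] : exists y, eX r y.
  have [x xX xr] : exists2 x, x \in X & x != r.
    apply/exists_inP; apply: contraR Xr => /exists_inPn H.
    rewrite finset.eqEsubset; apply/andP; split; last by rewrite finset.sub1set.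
    by apply/fintype.subsetP => x /H; rewrite negbK inE.
  have /connectP[[|y s] /= sp xE] := Xconn x xX; first by rewrite xE eqxx in xr.
  by exists y; case/andP: sp.
case/lastP E : (tval q) qp qu qext => [|q' l].
  move=> _ _ /(_ y0) /=; case/and3P: ry0 => ery -> ->.
  rewrite ery inE /= andbT negbK => /eqP ry.
  by rewrite ry e_irr in ery.
rewrite rcons_path => /andP[q'p q'l] qu qext.
have [epl pX lX] := and3P q'l.
have pl : last r q' != l by apply: contraTneq epl => ->; rewrite e_irr.
exists l, (last r q'); split => //.
  apply: contraTneq qu => ->; by rewrite /= mem_rcons mem_head.
move=> y yX ely; apply/eqP/negPn/negP => yp.
have yl : y != l by apply: contraTneq ely => ->; rewrite e_irr.
(* A neighbour of [l] in [X] off the path would lengthen it, so [y] lies on the path. *)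
have yq : y \in r :: rcons q' l.
  apply: contraR (qext y) => ny.
  rewrite -rcons_cons rcons_uniq ny qu rcons_path last_rcons rcons_path q'p q'l.
  by rewrite /= ely lX yX.
have {yq} yq' : y \in r :: q'.
  by move: yq; rewrite -rcons_cons mem_rcons inE (negbTE yl).
have q'e : path e r q'.
  by apply: sub_path q'p => u v /= /and3P[].
(* The stretch from [y] to [l], closed by the edge [e l y], is a simple cycle; it has at least three
   vertices because [y] is not the predecessor of [l]. *)
case/splitPl: yq' q'e yp epl qu => p1 p2 yE.
rewrite cat_path yE => /andP[_]; case: p2 => [|z p2] yp2; first by rewrite last_cat yE eqxx.
rewrite last_cat [last _ (_ :: _)]/= => _ epl qu.
have /negP[] : ~~ ucycleb e (y :: rcons (z :: p2) l).
  by apply: e_acyclic; rewrite /= size_rcons.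
apply/andP; split.
  rewrite (cycle_path y) [last _ _]/= last_rcons.
  by move: yp2 => /= /andP[yz zp2]; rewrite ely yz rcons_path zp2.
move: qu; rewrite rcons_cat -cat_cons lastI yE cat_rcons cat_uniq.
by case/and3P.
Qed.

(* Folding the leaf [l] onto its neighbour [p] maps paths to paths. *)
Lemma connect_retract (l p s t : T) (f : rel T) :
  symmetric f -> irreflexive f -> (forall y, f l y -> y = p) -> p != l ->
  s != l -> t != l -> connect f s t ->
  connect [rel x y | [&& f x y, x != l & y != l]] s t.
Proof.
move=> f_sym f_irr lp pl sl tl /connectP[q].
pose g x := if x == l then p else x.
suff H x : path f x q -> t = last x q ->
    connect [rel x y | [&& f x y, x != l & y != l]] (g x) t.
  by move=> qp qt; have := H s qp qt; rewrite /g (negbTE sl).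
elim: q x => [|y q IH] x /=.
  by move=> _ <-; rewrite /g (negbTE tl).
case/andP=> fxy yq tE; apply: connect_trans (IH y yq tE).
rewrite /g; have [xl|xl] := eqVneq x l.
  have -> : y = p by apply: lp; rewrite -xl.
  by rewrite (negbTE pl).
have [yl|yl] := eqVneq y l.
  have -> // : x = p by apply: lp; rewrite f_sym -yl.
by apply: connect1; rewrite /= fxy xl.
Qed.

End Trees.

(** * Elimination orders extracted from a tree decomposition *)

Section Elimination.
Variable Q : query.
Implicit Types (E : {set {set vars Q}}) (s : seq (vars Q)).

(** An elimination only adds a subset of a union of present hyperedges, so a common bound survives.
    This settles the stage where one bag remains. *)
Lemma elim_sets_sub E s (B : {set vars Q}) :
  (forall S, S \in E -> S \subset B) ->
  forall U, U \in elim_sets E s -> U \subset B.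
Proof.
elim: s E => [|v s IH] E EB U //=; rewrite inE.
have UB : (\bigcup_(S in E | v \in S) S)%SET \subset B.
  by apply/bigcupsP => S /andP[/EB].
case/predU1P => [->//|]; apply: IH => S.
rewrite !inE => /orP[/eqP->|/andP[/EB//]].
by apply: fintype.subset_trans UB; rewrite subD1set.
Qed.

Variables (D : tree_decomp Q) (K F : {set vars Q}) (r : node D).
Hypotheses (KF : K \subset F) (FK : F \subset K :|: bag r).

Let inner (X : {set node D}) (P : pred (node D)) : rel (node D) :=
  [rel x y | [&& tedge x y, x \in X, y \in X, P x & P y]].

(** With [predT] this makes [X] a subtree; with membership of [v] in the bag it is the running
    intersection property on [X]. *)
Let connected_in (X : {set node D}) (P : pred (node D)) := forall x y,
  x \in X -> y \in X -> P x -> P y -> connect (inner X P) x y.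

(* Induction on #|X| + #|W|: [X] is what remains of the tree and [W] the set of
   variables outside [F] still to be eliminated. *)
Lemma elim_order (X : {set node D}) (W : {set vars Q}) E :
  r \in X -> connected_in X predT ->
  (forall v, connected_in X (fun x => v \in bag x)) ->
  (forall v, v \in W -> v \notin F) ->
  (forall S, S \in E -> exists2 t, t \in X & S \subset bag t :|: K) ->
  (forall S, S \in E -> S \subset W :|: F) ->
  exists2 s, perm_eq s (enum W) &
    forall s' U, U \in elim_sets E (s ++ s') ->
      exists t : node D, U \subset bag t :|: K.
Proof.
have [n] := ubnP (#|X| + #|W|)%N; elim: n X W E => // n IH X W E le_n.
move=> rX Xconn Xbag WF Ebag EWF.
have [XE|Xr] := eqVneq X [set r]%SET.
  exists (enum W) => // s' U /elim_sets_sub UB; exists r; apply: UB => S SE.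
  by have [t] := Ebag S SE; rewrite XE inE => /eqP->.
have e_irr := @tedge_irr _ D; have e_sym := @tedge_sym _ D.
have [l [p [lX pX lr pl lp]]] : exists l p, [/\ l \in X, p \in X, l != r, p != l &
    forall y, y \in X -> tedge l y -> y = p].
  apply: (tree_leaf e_irr (@tedge_acyclic _ D) rX Xr) => x xX.
  apply: connect_sub (Xconn r x rX xX isT isT) => u v /= /and5P[uv uX vX _ _].
  by apply: connect1; rewrite /= uv uX.
(* A walk inside [X] from [l] to [t] through bags containing [v] must leave [l] by [p]. *)
have leaf_bag v t : v \in bag l -> t \in X -> t != l -> v \in bag t -> v \in bag p.
  move=> vl tX tl vt; have /connectP[[|y q] /=] := Xbag v l t lX tX vl vt.
    by move=> _ tE; rewrite tE eqxx in tl.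
  by case/andP => /and5P[/lp ly _ yX _ vy] _ _; rewrite -ly.
have Kdisj v : v \in W -> v \notin K.
  by move=> vW; apply: contra (WF v vW); exact: (fintype.subsetP KF).
case: (pickP [pred v | [&& v \in W, v \in bag l & v \notin bag p]]) => [v|noV].
  move=> /and3P[vW vl vp].
  set U := (\bigcup_(S in E | v \in S) S)%SET.
  (* Since [v] is outside [K] and occurs in no remaining bag but that of [l], each hyperedge through
     [v] is housed at [l]. *)
  have UB : U \subset bag l :|: K.
    apply/bigcupsP => S /andP[SE vS]; have [t tX St] := Ebag S SE.
    have := fintype.subsetP St v vS; rewrite inE (negbTE (Kdisj v vW)) orbF => vt.
    have [<-//|tl] := eqVneq t l.
    by rewrite (leaf_bag v t) in vp.
  have UWF : U \subset W :|: F by apply/bigcupsP => S /andP[/EWF].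
  have vF : v \notin F by exact: WF.
  have [||S|S|s sW sB] := IH X (W :\ v)
      ((U :\ v) |: [set S in E | v \notin S])%SET _ rX Xconn Xbag.
  - by move: le_n; rewrite (cardsD1 v W) vW addnS.
  - by move=> u /setD1P[_ /WF].
  - rewrite !inE => /orP[/eqP->|/andP[/Ebag//]].
    by exists l => //; apply: fintype.subset_trans UB; rewrite subD1set.
  - rewrite !inE => /orP[/eqP->|/andP[SE vS]].
      apply/fintype.subsetP => u; rewrite !inE => /andP[->].
      by move/(fintype.subsetP UWF); rewrite inE.
    apply/fintype.subsetP => u uS; rewrite !inE.
    have -> : u != v by apply: contraNneq vS => <-.
    by have := fintype.subsetP (EWF S SE) u uS; rewrite inE.
  exists (v :: s).
    apply: uniq_perm; rewrite /= ?enum_uniq //.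
      rewrite (perm_mem sW) mem_enum !inE eqxx /=.
      by rewrite (perm_uniq sW) enum_uniq.
    by move=> u; rewrite inE (perm_mem sW) !mem_enum !inE; case: eqVneq => // ->.
  move=> s' U' /=; rewrite inE => /predU1P[->|/sB//].
  by exists l.
have sub_in P : connected_in X P -> connected_in (X :\ l) P.
  move=> XP x y; rewrite !in_setD1 => /andP[xl xX] /andP[yl yX] Px Py.
  have fs : symmetric (inner X P).
    by move=> u v; rewrite /inner /= e_sym; apply/and5P/and5P => -[].
  have fi : irreflexive (inner X P) by move=> u; rewrite /inner /= e_irr.
  have fl z : inner X P l z -> z = p by move=> /and5P[/lp lz _ /lz].
  apply: connect_sub (connect_retract fs fi fl pl xl yl (XP x y xX yX Px Py)).
  move=> u v /= /and3P[/and5P[uv uX vX Pu Pv] ul vl]; apply: connect1.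
  by rewrite /inner /= !in_setD1 uv uX vX Pu Pv ul vl.
apply: (IH (X :\ l) W E) => //.
- by move: le_n; rewrite (cardsD1 l X) lX.
- by rewrite in_setD1 eq_sym lr.
- exact: sub_in.
- by move=> v; exact: sub_in.
(* Hyperedges housed at the pruned leaf move to [p]: a variable of [W] in the leaf is also in
   [bag p] by [noV], and one of [F] outside [K] is in [bag r], hence in [bag p] by [leaf_bag]. *)
move=> S SE; have [t tX St] := Ebag S SE.
have [tl|tl] := eqVneq t l; last by exists t => //; rewrite in_setD1 tl.
exists p; first by rewrite in_setD1 pl.
apply/fintype.subsetP => v vS; rewrite inE.
have := fintype.subsetP St v vS; rewrite tl inE orbC.
case: (boolP (v \in K)) => [_|vK] /=; first by rewrite orbT.
rewrite orbF => vl; have := fintype.subsetP (EWF S SE) v vS; rewrite inE => /orP[vW|vF].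
  by have := noV v; rewrite /= vW vl /= => /negbFE.
apply: (leaf_bag v r) => //; first by rewrite eq_sym.
by have := fintype.subsetP FK v vF; rewrite inE (negbTE vK).
Qed.

End Elimination.

(** * Growth of the fractional cover number and the bound on the elimination width *)

Section WidthBounds.
Variables (R : realType) (Q : query).
Implicit Types (A B F : {set vars Q}) (w : rels Q -> R).

Lemma fractional_cover1 B : fractional_cover B (fun=> 1 : R).
Proof.
split=> [r|v _]; first exact: ler01.
have [r vr] := schema_cover v.
by rewrite (bigD1 r) //= lerDl sumr_ge0.
Qed.

Lemma le_rho B (x : R) :
  (forall w, fractional_cover B w -> x <= \sum_r w r) -> x <= rho R B.
Proof.
move=> H; apply: lb_le_inf; last by move=> _ [w /H wx <-].
by eexists; exists (fun=> 1); first exact: fractional_cover1.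
Qed.

Lemma rho_le B w : fractional_cover B w -> rho R B <= \sum_r w r.
Proof.
move=> wB; apply: ge_inf; last by exists w.
by exists 0 => _ [u [u0 _] <-]; apply: sumr_ge0.
Qed.

Lemma rho_ge0 B : 0 <= rho R B.
Proof. by apply: le_rho => w [w0 _]; apply: sumr_ge0. Qed.

Lemma rho_ge1 B v : v \in B -> 1 <= rho R B.
Proof.
move=> vB; apply: le_rho => w [w0 /(_ v vB) /le_trans]; apply.
by rewrite [leRHS](bigID (fun r => v \in schema r)) /= lerDl sumr_ge0.
Qed.

Lemma rho_sub A B : A \subset B -> rho R A <= rho R B.
Proof.
move=> /fintype.subsetP AB; apply: le_rho => w [w0 wB].
by apply: rho_le; split=> // v /AB /wB.
Qed.

(** Adding weight one to a single relation containing [v] turns a cover of [B] into one of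
    [v |: B]. *)
Lemma rho_setU1 B v : rho R (v |: B) <= rho R B + 1.
Proof.
rewrite -lerBlDr; apply: le_rho => w [w0 wB]; rewrite lerBlDr.
have [r vr] := schema_cover v.
have -> : \sum_s w s + 1 = \sum_s (w s + (s == r)%:R).
  rewrite big_split; congr (_ + _); rewrite (bigD1 r) //= eqxx big1 ?addr0 //.
  by move=> s /negbTE->.
apply: rho_le; split=> [s|u]; first by rewrite addr_ge0.
rewrite big_split in_setU1 /= => /predU1P[->|/wB ux].
  rewrite -[leLHS]add0r lerD ?sumr_ge0 // (bigD1 r) //= eqxx lerDl sumr_ge0 //.
by rewrite -[leLHS]addr0 lerD ?sumr_ge0.
Qed.

Lemma rho_setU B K : rho R (B :|: K) <= rho R B + #|K|%:R.
Proof.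
have [n] := ubnP #|K|; elim: n K => // n IH K; have [->|[v vK]] := set_0Vmem K.
  by rewrite finset.setU0 cards0 addr0.
rewrite (cardsD1 v) vK add1n => /IH {}IH.
rewrite -natr1 addrA -{1}(finset.setD1K vK) finset.setUCA.
by apply: le_trans (rho_setU1 _ _) _; rewrite lerD2r.
Qed.

(** [elim_order] on the whole tree removes the variables outside [F]; [enum F] is appended and the
    list reversed, so that [F] comes first. Each elimination set lies in a bag enlarged by [K], and
    each variable of [K] costs at most one. *)
Lemma faqw_le_td_width (D : tree_decomp Q) (r : node D) (F K : {set vars Q}) :
  K \subset F -> F \subset K :|: bag r ->
  faqw R F <= td_width R D + #|K|%:R.
Proof.
move=> KF FK.
have [|v||S|S|s sW sB] := @elim_order Q D K F r KF FK [set: node D]%SET (~: F)%SET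
  (hyperedges Q) (finset.in_setT r).
- move=> x y _ _ _ _; apply: connect_sub (tedge_connected x y) => u v uv.
  by apply: connect1; rewrite /= uv !finset.in_setT.
- move=> x y _ _ vx vy; apply: connect_sub (bag_connected vx vy) => u w /and3P[uw vu vw].
  by apply: connect1; rewrite /= uw !finset.in_setT vu.
- by move=> v; rewrite inE.
- case/imsetP=> q _ ->; have [t qt] := bag_cover D q; exists t; rewrite ?finset.in_setT //.
  by apply: fintype.subset_trans qt _; rewrite finset.subsetUl.
- by move=> _; apply/fintype.subsetP => v _; rewrite !inE orNb.
apply: (@le_trans _ _ (faqw_ord R (rev (s ++ enum F)))).
  apply: ge_inf.
    by exists 0 => _ [u _ <-]; apply: bigmax_ge_id.
  exists (rev (s ++ enum F)) => //; split.
    rewrite perm_rev; apply: uniq_perm.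
    - rewrite cat_uniq (perm_uniq sW) !enum_uniq andbT; apply/hasPn => v /=.
      by rewrite mem_enum (perm_mem sW) mem_enum inE negbK.
    - exact: enum_uniq.
    by move=> v; rewrite mem_cat (perm_mem sW) !mem_enum !inE orNb.
  move=> u v uF vF; rewrite rev_cat !index_cat !mem_rev !mem_enum uF (negbTE vF).
  by rewrite (leq_trans _ (leq_addr _ _)) // index_mem mem_rev mem_enum.
rewrite /faqw_ord revK big_seq; apply: bigmax_le => [|U /sB[t Ut]].
  by rewrite addr_ge0 //; apply: bigmax_ge_id.
apply: le_trans (rho_sub Ut) _; apply: le_trans (rho_setU _ _) _.
by rewrite lerD2r; exact: (le_bigmax _ (fun t => rho R (bag t))).
Qed.

(** One node carrying all variables. Bounding the infimum [fhtw] from below requires a nonempty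
    set. *)
Lemma tree_decomp_inhabited : inhabited (tree_decomp Q).
Proof.
apply: inhabits.
have irr : irreflexive [rel x y : unit | false] by [].
refine (@TreeDecomp Q unit [rel x y | false] (fun=> [set: vars Q]%SET) _ _ irr _ _ _ _).
- by rewrite card_unit.
- by [].
- by case=> -[]; exact: connect0.
- by case=> [|[] [|[] s]] //= _; rewrite /ucycleb /= andbF.
- by move=> r; exists tt; apply/fintype.subsetP => v _; rewrite finset.in_setT.
- by move=> v [] [] _ _; exact: connect0.
Qed.

(** The unit is saved because one variable of [F] already lies in the bag chosen as root [r]. *)
Lemma faqw_le_fhtw (F : {set vars Q}) : faqw R F <= fhtw R Q + (#|F|.-1)%:R.
Proof.
rewrite -lerBlDr; apply: lb_le_inf.
  by have [D] := tree_decomp_inhabited; exists (td_width R D), D.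
move=> _ [D ->]; rewrite lerBlDr.
(* For empty [F] the predecessor is truncated to 0, matching an empty [K]; any node can then be the
   root. *)
have [F0|[v vF]] := set_0Vmem F.
  have /card_gt0P[r _] := node_nonempty D.
  have := @faqw_le_td_width D r F finset.set0.
  by rewrite F0 cards0 /=; apply; rewrite finset.sub0set.
have [q vq] := schema_cover v; have [r /fintype.subsetP qr] := bag_cover D q.
rewrite (cardsD1 v) vF /=; apply: (@faqw_le_td_width D r); first exact: subD1set.
apply/fintype.subsetP => u uF; rewrite !inE uF andbT.
by have [->|//] := eqVneq u v; rewrite qr.
Qed.

Lemma fhtw_ge1 (v : vars Q) : 1 <= fhtw R Q.
Proof.
apply: lb_le_inf; first by have [D] := tree_decomp_inhabited; exists (td_width R D), D.
move=> _ [D ->]; have [q vq] := schema_cover v.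
have [r /fintype.subsetP/(_ v vq) vr] := bag_cover D q.
apply: le_trans (rho_ge1 vr) _; exact: (le_bigmax _ (fun t => rho R (bag t))).
Qed.

End WidthBounds.

(** * Convexity of the exponential and a generalized Hoelder inequality *)

Section Holder.
Variable R : realType.

(** The tangent to the exponential at the weighted mean [L] lies below the graph, and its linear
    term averages to zero. *)
Lemma expR_jensen (I : finType) (P : pred I) (l y : I -> R) :
  (forall i, P i -> 0 <= l i) -> \sum_(i | P i) l i = 1 ->
  expR (\sum_(i | P i) l i * y i) <= \sum_(i | P i) l i * expR (y i).
Proof.
move=> l0 l1; set L := \sum_(i | P i) l i * y i.
have -> : expR L = \sum_(i | P i) l i * (expR L * (1 + (y i - L))).
  rewrite (eq_bigr (fun i => expR L * (l i * y i) + (expR L * (1 - L)) * l i)); last first.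
    by move=> i _; ring.
  by rewrite big_split -!mulr_sumr l1 /= -/L; ring.
apply: ler_sum => i Pi; apply: ler_wpM2l; first exact: l0.
have -> : expR (y i) = expR L * expR (y i - L) by rewrite -expRD addrC subrK.
by rewrite ler_wpM2l ?expR_ge0 ?expR_ge1Dx.
Qed.

(* Each [n x i / S i] is at most [1], so the exponents may be scaled down to
   have sum [1]; convexity of the exponential then bounds every summand. *)
Lemma holder_prod (X I : finType) (P : pred I) (w : I -> R) (n : X -> I -> R) :
  (forall i, 0 <= w i) -> 1 <= \sum_(i | P i) w i ->
  (forall x i, 0 < n x i) ->
  \sum_x \prod_(i | P i) n x i `^ w i <= \prod_(i | P i) (\sum_x n x i) `^ w i.
Proof.
move=> w0 w1 n0; set W := \sum_(i | P i) w i; pose S i := \sum_x n x i.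
have W0 : 0 < W by apply: lt_le_trans w1.
have Wn0 : W != 0 by rewrite gt_eqF.
have nS x i : n x i <= S i by rewrite /S (bigD1 x) //= lerDl sumr_ge0 // => z _; exact: ltW.
case: (pickP (@predT X)) => [x0 _|noX]; last first.
  rewrite big1 => [|x _]; last by have := noX x.
  by apply: prodr_ge0 => i _; exact: powR_ge0.
have S0 i : 0 < S i by apply: lt_le_trans (nS x0 i).
pose q x i := n x i / S i.
have q0 x i : 0 < q x i by rewrite divr_gt0.
have qE x : \prod_(i | P i) n x i `^ w i =
    \prod_(i | P i) S i `^ w i * \prod_(i | P i) q x i `^ w i.
  rewrite -big_split /=; apply: eq_bigr => i _.
  by rewrite -powRM ?(ltW (S0 _)) ?(ltW (q0 _ _)) // mulrC divfK ?gt_eqF.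
rewrite (eq_bigr _ (fun x _ => qE x)) -mulr_sumr.
rewrite -[leRHS]mulr1 ler_wpM2l //; first by apply: prodr_ge0 => i _; exact: powR_ge0.
have qle x : \prod_(i | P i) q x i `^ w i <= \sum_(i | P i) w i / W * q x i.
  rewrite (eq_bigr (fun i => expR (w i * ln (q x i)))); last first.
    by move=> i _; rewrite /powR gt_eqF.
  rewrite -expR_sum; apply: (@le_trans _ _ (expR (\sum_(i | P i) w i / W * ln (q x i)))).
    rewrite ler_expR; apply: ler_sum => i _.
    have lq : ln (q x i) <= 0 by rewrite ln_le0 // ler_pdivrMr // mul1r.
    by apply: ler_wnM2r => //; rewrite ler_pdivrMr // ler_peMr.
  apply: le_trans (expR_jensen _ _ _) _.
  - by move=> i _; rewrite divr_ge0 // ltW.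
  - by rewrite -mulr_suml -/W mulfV.
  by apply: ler_sum => i _; rewrite lnK ?posrE ?q0.
apply: le_trans (ler_sum _ (fun x _ => qle x)) _.
(* For each [i] the ratios [q x i] sum to 1 over [x], and the weights [w i / W] sum to 1 over
   [i]. *)
rewrite exchange_big /= (eq_bigr (fun i => w i / W)); last first.
  by move=> i _; rewrite -mulr_sumr -mulr_suml -/(S i) mulfV ?mulr1 ?gt_eqF.
by rewrite -mulr_suml -/W mulfV.
Qed.

End Holder.

(** * Counting projections of a finite set of tuples *)

Section Projections.

(** On [A], [f] factors through [h]: [g] evaluates [f] at a chosen preimage, so the image of [f] is
    covered by that of [g] on the image of [h]. *)
Lemma card_imfset_determined (T U W : choiceType) (A : {fset T})
    (f : T -> U) (h : T -> W) :
  {in A &, forall t u, h t = h u -> f t = f u} ->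
  (#|` (f @` A)%fset| <= #|` (h @` A)%fset|)%N.
Proof.
move=> hf; have [->|[t0 t0A]] := fset_0Vmem A; first by rewrite !imfset0 !cardfs0.
pose g u := f (xget t0 [set t | t \in A /\ h t = u]).
suff /fsubset_leq_card le1 : (f @` A `<=` g @` (h @` A))%fset.
  by apply: leq_trans le1 _; rewrite leq_imfset_card.
apply/fsubsetP => _ /imfsetP[t /= tA ->]; apply/imfsetP; exists (h t) => /=.
  by rewrite in_imfset.
rewrite /g; case: xgetP => [u _ [uA hu]|/(_ t)[]]; last by [].
by apply: hf.
Qed.

Lemma card_fset_fibers (T U : choiceType) (A : {fset T}) (f : T -> U) :
  #|` A| = (\sum_(x <- (f @` A)%fset) #|` [fset t in A | f t == x]%fset|)%N.
Proof.
rewrite card_fset_sum1 (partition_big_imfset _ f); apply: eq_bigr => x _.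
by rewrite card_fset_sum1 big_fset.
Qed.

Variables (R : realType) (V I : finType) (T : choiceType) (x0 : T).
Variables (sch : I -> {set V}) (w : I -> R).
Hypothesis w_ge0 : forall i, 0 <= w i.
Implicit Types (A : {fset {ffun V -> T}}) (B : {set V}).

(** Padding with [x0] keeps projections on different sets in one type, which the induction on [B]
    needs. *)
Definition restrict B (t : {ffun V -> T}) : {ffun V -> T} :=
  [ffun v => if v \in B then t v else x0].

Definition nproj B A := #|` (restrict B @` A)%fset|.

Lemma restrict_eqP B t u :
  (restrict B t = restrict B u) <-> {in B, forall v, t v = u v}.
Proof.
split=> [/ffunP tu v vB|tu]; first by have := tu v; rewrite !ffunE vB.
by apply/ffunP => v; rewrite !ffunE; case: ifP => // /tu.
Qed.

Lemma leq_nproj B B' A :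
  {in A &, forall t u : {ffun V -> T},
    {in B, forall v, t v = u v} -> {in B', forall v, t v = u v}} ->
  (nproj B' A <= nproj B A)%N.
Proof.
move=> H; apply: card_imfset_determined => t u tA uA /restrict_eqP tu.
by apply/restrict_eqP; apply: H.
Qed.

Definition slice v A (x : T) := [fset t in A | t v == x]%fset.

Lemma leq_nprojA B A A' : (A `<=` A')%fset -> (nproj B A <= nproj B A')%N.
Proof.
move=> /fsubsetP AA; apply/fsubset_leq_card/fsubsetP => _ /imfsetP[t /= /AA tA ->].
by rewrite in_imfset.
Qed.

(** A projection on [B] amounts to its value at [v] together with the projection on [B :\ v] of a
    tuple in that slice. *)
Lemma nproj_slices B A v : v \in B ->
  nproj B A = (\sum_(x <- ((fun t : {ffun V -> T} => t v) @` A)%fset)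
    nproj (B :\ v) (slice v A x))%N.
Proof.
move=> vB; have rv t : restrict B t v = t v by rewrite ffunE vB.
rewrite /nproj (card_fset_fibers _ (fun u : {ffun V -> T} => u v)).
have -> : ((fun u : {ffun V -> T} => u v) @` (restrict B @` A) =
    (fun t : {ffun V -> T} => t v) @` A)%fset.
  apply/fsetP => x; apply/imfsetP/imfsetP => -[t tA ->].
    by have /imfsetP[u uA ->] := tA; exists u.
  by exists (restrict B t); rewrite /= ?in_imfset.
apply: eq_bigr => x _.
have -> : [fset u in (restrict B @` A)%fset | u v == x]%fset =
    (restrict B @` slice v A x)%fset.
  apply/fsetP => u; rewrite !inE; apply/andP/imfsetP => [[/imfsetP[t /= tA ->]]|].
    by rewrite rv => tx; exists t; rewrite // !inE tA tx.
  by case=> t; rewrite !inE => /andP[tA tx] ->; rewrite rv tx in_imfset.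
apply/eqP; rewrite eqn_leq; apply/andP; split; apply: leq_nproj => t u.
  rewrite !inE => /andP[_ /eqP tx] /andP[_ /eqP ux] tu y yB.
  by have [->|yv] := eqVneq y v; [rewrite tx ux | apply: tu; rewrite !inE yv].
by move=> _ _ tu y /setD1P[_ /tu].
Qed.

Lemma nproj_gt0 B A t : t \in A -> (0 < nproj B A)%N.
Proof.
by move=> tA; rewrite cardfs_gt0; apply/fset0Pn; exists (restrict B t); rewrite in_imfset.
Qed.

(* Induction on [B]: split [A] by the value at some [v] in [B], apply the
   induction hypothesis to every slice, and recombine by Hoelder's inequality. *)
Lemma nproj_le_prod B A :
  (forall v, v \in B -> 1 <= \sum_(i | v \in sch i) w i) ->
  (nproj B A)%:R <= \prod_i ((nproj (B :&: sch i) A)%:R : R) `^ w i.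
Proof.
have [n] := ubnP #|B|; elim: n B A => // n IH B A; have [->|[v vB]] := set_0Vmem B.
  move=> _ _; have [->|[t tA]] := fset_0Vmem A.
    by rewrite {1}/nproj imfset0 cardfs0; apply: prodr_ge0 => i _; exact: powR_ge0.
  have nproj0 : nproj finset.set0 A = 1%N.
    apply/eqP; rewrite eqn_leq (nproj_gt0 _ tA) andbT -(cardfs1 (restrict finset.set0 t)).
    apply/fsubset_leq_card/fsubsetP => _ /imfsetP[u _ ->]; rewrite inE; apply/eqP.
    by apply/restrict_eqP => v; rewrite inE.
  by rewrite nproj0 big1 // => i _; rewrite finset.set0I nproj0 powR1.
rewrite (cardsD1 v) vB add1n => Bn cov.
pose X := ((fun t : {ffun V -> T} => t v) @` A)%fset.
pose N (x : X) i := (nproj ((B :\ v) :&: sch i) (slice v A (val x)))%:R : R.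
(* Nonempty slices give the positivity required by [holder_prod]. *)
have slice_mem (x : X) : exists t, t \in slice v A (val x).
  by have /imfsetP[t /= tA xE] := valP x; exists t; rewrite !inE tA xE /=.
rewrite (nproj_slices _ vB) big_seq_fsetE natr_sum.
apply: (@le_trans _ _ (\sum_(x : X) \prod_i N x i `^ w i)).
  by apply: ler_sum => x _; apply: IH => // u /setD1P[_ /cov].
rewrite [leRHS](bigID (fun i => v \in sch i)) /=.
(* Factors whose schema misses [v] are bounded by their value on all of [A] and leave the sum;
   Hoelder handles the factors that see [v], whose total weight is at least 1. *)
apply: (@le_trans _ _ (\sum_(x : X) (\prod_(i | v \in sch i) N x i `^ w i) *
    \prod_(i | v \notin sch i) (nproj (B :&: sch i) A)%:R `^ w i)).
  apply: ler_sum => x _; rewrite (bigID (fun i => v \in sch i)) /=.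
  apply: ler_wpM2l; first by apply: prodr_ge0 => i _; exact: powR_ge0.
  apply: ler_prod => i vi; rewrite powR_ge0 /=; apply: ge0_ler_powR; rewrite ?nnegrE //.
  rewrite ler_nat; apply: leq_trans (leq_nprojA _ _) (leq_nproj _).
    by apply/fsubsetP => t; rewrite !inE => /andP[].
  by move=> t u _ _ tu y; rewrite !inE => /andP[/andP[_ yB] yi]; apply: tu; rewrite inE yB.
rewrite -mulr_suml; apply: ler_wpM2r; first by apply: prodr_ge0 => i _; exact: powR_ge0.
apply: le_trans (holder_prod w_ge0 (cov v vB) _) _ => [x i|].
  by rewrite ltr0n; have [t] := slice_mem x; exact: nproj_gt0.
apply: ler_prod => i vi; rewrite powR_ge0 /=.
(* The slice counts add up again, as [v] belongs to [B :&: sch i]. *)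
rewrite (@nproj_slices (B :&: sch i) A v) ?inE ?vB // big_seq_fsetE natr_sum.
by rewrite /N /X; under eq_bigr do rewrite finset.setIDAC.
Qed.

End Projections.

(** * The fractional cover bound for projections of the join and the sparse tensor size *)

Section SparseSize.
Variables (R : realType) (L : choiceType) (Q : query) (F : features Q).
Variable I : instance R L F.

(** Every variable lies in some relation, so a join tuple can be glued back from its projections,
    which range over a finite product. *)
Lemma finite_join : finite_set (join I).
Proof.
have sch (v : vars Q) : {r | v \in schema r} by apply: cid; exact: schema_cover.
pose glue (f : {dffun forall r, relation I r}) : full_tuple R L Q :=
  [ffun v => val (f (sval (sch v))) (exist _ v (svalP (sch v)))].
apply: (@sub_finite_set _ _ (range glue)); last exact/finite_image/finite_finset.
move=> t tI; exists [ffun r => [` tI r]%fset] => //.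
by apply/ffunP => v; rewrite !ffunE.
Qed.

Lemma fset_joinP t : reflect (join I t) (t \in fset_set (join I)).
Proof.
rewrite in_fset_set; last exact: finite_join.
by apply: (iffP idP) => [/set_mem|/mem_set].
Qed.

Lemma card_proj_join (B : {set vars Q}) : (0 < instance_size I)%N ->
  #|` (Defs.proj B @` fset_set (join I))%fset|%:R <= (instance_size I)%:R `^ rho R B.
Proof.
set A := fset_set (join I); set N := instance_size I => N0.
have N1 : 1 <= N%:R :> R by rewrite ler1n.
have lnN0 : 0 <= ln (N%:R : R) by exact: ln_ge0.
have powNE x : (N%:R : R) `^ x = expR (x * ln N%:R).
  by rewrite /powR gt_eqF // ltr0n.
have proj_restrict S : (#|` (Defs.proj S @` A)%fset| <= nproj (inl 0%R : value R L) S A)%N.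
  apply: card_imfset_determined => t u _ _ /restrict_eqP tu.
  by apply/ffunP => v; rewrite !ffunE; apply: tu; exact: valP.
have restrict_le (S : {set vars Q}) r : S \subset schema r ->
    (nproj (inl 0%R : value R L) S A <= N)%N.
  move=> /fintype.subsetP Sr; apply: (@leq_trans #|` relation I r|); last exact: leq_bigmax.
  apply: (@leq_trans #|` (Defs.proj (schema r) @` A)%fset|).
    apply: card_imfset_determined => t u _ _ /ffunP tu; apply/restrict_eqP => v /Sr vr.
    by have := tu (exist _ v vr); rewrite !ffunE.
  apply/fsubset_leq_card/fsubsetP => _ /imfsetP[t /= tA ->].
  by move/fset_joinP: tA => /(_ r).
set k := #|` _|; have [->|k0] := posnP k; first exact: powR_ge0.
have kw w : fractional_cover B w -> k%:R <= (N%:R : R) `^ (\sum_r w r).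
  move=> [w0 wB]; apply: le_trans (_ : (nproj (inl 0%R : value R L) B A)%:R <= _).
    by rewrite ler_nat; exact: proj_restrict.
  apply: le_trans (@nproj_le_prod _ _ _ _ _ (@schema Q) w w0 B A wB) _.
  rewrite powNE mulr_suml expR_sum; apply: ler_prod => r _.
  rewrite -powNE powR_ge0 /=; apply: ge0_ler_powR; rewrite ?nnegrE //.
  by rewrite ler_nat (@restrict_le _ r) // finset.subsetIr.
(* In logarithmic form the bound is linear in the total weight, so it passes to the infimum over
   covers. *)
have ln_le x : (k%:R <= (N%:R : R) `^ x) = (ln k%:R <= x * ln (N%:R : R)).
  by rewrite powNE -[in LHS](@lnK _ k%:R) ?posrE ?ltr0n // ler_expR.
rewrite ln_le.
have kln w : fractional_cover B w -> ln (k%:R : R) <= (\sum_r w r) * ln N%:R.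
  by move=> /kw; rewrite ln_le.
(* Division by [ln N] is impossible when it vanishes; then both right-hand sides are 0 and any one
   cover suffices. *)
have [lnN|lnN] := eqVneq (ln (N%:R : R)) 0.
  by have := kln _ (fractional_cover1 R B); rewrite lnN !mulr0.
have lnNp : 0 < ln (N%:R : R) by rewrite lt_def lnN.
by rewrite -ler_pdivrMr //; apply: le_rho => w /kln; rewrite ler_pdivrMr.
Qed.

(** The tensor value in an entry depends on [t] only through its projections on the two categorical
    sets, hence on the key: there are no more entries than keys. *)
Lemma sigma_size_le (a b : vars Q -> nat) :
  (sigma_size I a b <=
    #|` (Defs.proj (cvars F a :|: cvars F b) @` fset_set (join I))%fset|)%N.
Proof.
rewrite /sigma_size /sigma_sparse fset_set_image; last exact: finite_join.
apply: card_imfset_determined => t u _ _ tu.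
have tuE v : v \in cvars F a :|: cvars F b -> t v = u v.
  by move=> vab; move/ffunP/(_ (exist _ v vab)): tu; rewrite !ffunE.
have tuP (S : {set vars Q}) : S \subset cvars F a :|: cvars F b ->
    Defs.proj S t = Defs.proj S u.
  move=> /fintype.subsetP SE; apply/ffunP => v; rewrite !ffunE; apply: tuE.
  by apply: SE; exact: valP.
by rewrite tu (tuP _ (finset.subsetUl _ _)) (tuP _ (finset.subsetUr _ _)).
Qed.

Lemma instance_size_gt0 t : join I t -> (0 < #|vars Q|)%N -> (0 < instance_size I)%N.
Proof.
move=> tI /card_gt0P[v _]; have [r _] := schema_cover v.
apply: (@leq_trans #|` relation I r|); last exact: leq_bigmax.
by rewrite cardfs_gt0; apply/fset0Pn; exists (Defs.proj (schema r) t); exact: tI.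
Qed.

Lemma sigma_size_le_powR (a b : vars Q -> nat) (c : nat) :
  (0 < #|vars Q|)%N -> (#|cvars F a :|: cvars F b| <= c)%N ->
  (sigma_size I a b)%:R <= (instance_size I)%:R `^ Num.min (rhostar R Q) c%:R.
Proof.
move=> V0 abc; have := sigma_size_le a b; set S := cvars F a :|: cvars F b in abc *.
have [->|[t]] := fset_0Vmem (fset_set (join I)).
  by rewrite imfset0 cardfs0 leqn0 => /eqP->; exact: powR_ge0.
move=> /fset_joinP /instance_size_gt0/(_ V0) N0 le1.
apply: (@le_trans _ _ (#|` (Defs.proj S @` fset_set (join I))%fset|%:R)).
  by rewrite ler_nat.
apply: le_trans (card_proj_join _ N0) _; apply: ler_powR; first by rewrite ler1n.
rewrite le_min rho_sub ?finset.subsetT //=.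
(* Building [S] from the empty set, whose cover number is 0, gives the bound by its cardinality. *)
have := rho_setU R finset.set0 S; rewrite finset.set0U => /le_trans; apply.
have -> : rho R (finset.set0 : {set vars Q}) = 0.
  apply/le_anti; rewrite rho_ge0 andbT.
  have /rho_le : fractional_cover (finset.set0 : {set vars Q}) (fun=> 0 : R).
    by split=> // v; rewrite inE.
  by rewrite big1.
by rewrite add0r ler_nat.
Qed.

End SparseSize.

(** * A gap between exponents beats a logarithmic factor *)

Lemma powR_div_cvgy (R : realType) (N S : nat -> R) (K b r : R) :
  b < r -> 0 < K -> N n @[n --> \oo] --> +oo ->
  (forall n, 1 < N n -> 0 < S n <= K * (N n `^ b * ln (N n))) ->
  N n `^ r / S n @[n --> \oo] --> +oo.
Proof.
(* Half the gap makes [N^r = N^b * (N^d)^2]; with [N^d >= d * ln N] the quotient is at least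
   [d^2 * ln N / K] once [N > 1]. *)
move=> br K0 Noo SN; apply/cvgryPge => A; pose d := (r - b) / 2.
have d0 : 0 < d by rewrite divr_gt0 // subr_gt0.
(* Threshold for [ln N]: the 1 forces [N > 1], the other entry makes that lower bound reach [A]. *)
pose M := Num.max 1 (K * A / d ^+ 2).
have : \forall n \near \oo, expR M <= N n by move/cvgryPge: Noo; apply.
apply: filterS => n MN.
have N0 : 0 < N n by apply: lt_le_trans MN; exact: expR_gt0.
have ML : M <= ln (N n) by rewrite -ler_expR lnK.
move: ML; rewrite ge_max => /andP[L1 AL].
have L0 : 0 < ln (N n) by apply: lt_le_trans L1.
have N1 : 1 < N n by rewrite -ltr_ln ?posrE // ln1.
have /andP[S0 Sle] := SN n N1.
rewrite ler_pdivlMr //.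
have [A0|A0] := leP A 0.
  by apply: le_trans (powR_ge0 _ _); rewrite mulr_le0_ge0 // ltW.
apply: le_trans (ler_wpM2l (ltW A0) Sle) _.
have Nr : N n `^ r = N n `^ b * expR (d * ln (N n)) ^+ 2.
  by rewrite /powR gt_eqF // -expRM_natl -expRD; congr expR; rewrite /d; field.
have dL : d * ln (N n) <= expR (d * ln (N n)).
  by apply: le_trans (expR_ge1Dx _); rewrite lerDr.
rewrite Nr.
have -> : A * (K * (N n `^ b * ln (N n))) = N n `^ b * (K * A * ln (N n)) by ring.
apply: ler_wpM2l; first exact: powR_ge0.
have dL0 : 0 <= d * ln (N n) by rewrite mulr_ge0 // ltW.
apply: le_trans (_ : (d * ln (N n)) ^+ 2 <= _); last by rewrite lerXn2r ?nnegrE ?expR_ge0.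
rewrite exprMn [X in _ <= _ * X]expr2 mulrA ler_wpM2r ?(ltW L0) //.
by rewrite [leRHS]mulrC -ler_pdivrMr ?exprn_gt0.
Qed.

(** * Instances of every prescribed size *)

Section DiagonalInstance.
Variables (R : realType) (L : choiceType) (Q : query) (F : features Q).

Definition const_tup (S : {set vars Q}) (k : nat) : tup R L S := [ffun=> inl k%:R].

(** Real entries make the relation admissible whichever features are continuous. *)
Definition diag_relation (n : nat) (r : rels Q) : {fset tup R L (schema r)} :=
  [fset t in [seq const_tup (schema r) k | k <- iota 0 n]]%fset.

Lemma diag_relation_real n r (t : tup R L (schema r))
    (v : {v : vars Q | v \in schema r}) :
  t \in diag_relation n r -> val v \in feat F :\: Defs.cat F ->
  exists x : R, t v = inl x.
Proof. by rewrite !inE => /mapP[k _ ->] _; exists k%:R; rewrite ffunE. Qed.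

Definition diag_instance (n : nat) : instance R L F :=
  Instance (@diag_relation_real n).

Lemma diag_instance_size (v : vars Q) n : instance_size (diag_instance n) = n.
Proof.
apply/eqP; rewrite eqn_leq; apply/andP; split.
  apply/bigmax_leqP => r _; rewrite card_fseq.
  by apply: leq_trans (size_undup _) _; rewrite size_map size_iota.
(* The constant tuples are distinct on a schema containing [v]; on an empty schema they would
   coincide. *)
have [r vr] := schema_cover v.
apply: leq_trans (leq_bigmax (F := fun r => #|` relation (diag_instance n) r|) r).
rewrite card_fseq undup_id ?size_map ?size_iota // map_inj_uniq ?iota_uniq // => k l.
by move=> /ffunP/(_ (exist _ v vr)); rewrite !ffunE => -[] /eqP; rewrite eqr_nat => /eqP.
Qed.

End DiagonalInstance.

(** * The denominator of the quotient, and the three claims together *)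

Lemma sum_powR_bounds (R : realType) (m : nat) (f : 'I_m -> 'I_m -> R) (x b mu : R) :
  (0 < m)%N -> 1 < x -> mu <= b -> (forall i j, f i j <= b) ->
  0 < \sum_i \sum_j (x `^ f i j + x `^ mu) * ln x <=
    (m * m * 2)%:R * (x `^ b * ln x).
Proof.
move=> m0 x1 mub fb; have x0 : 0 < x by apply: lt_trans x1.
have L0 : 0 < ln x by exact: ln_gt0.
have pos i j : 0 < (x `^ f i j + x `^ mu) * ln x by rewrite mulr_gt0 // addr_gt0 ?powR_gt0.
apply/andP; split.
  rewrite (bigD1 (Ordinal m0)) //= (bigD1 (Ordinal m0)) //=.
  rewrite -addrA ltr_pwDl // addr_ge0 ?sumr_ge0 // => i _; first exact: ltW.
  by apply: sumr_ge0 => j _; exact: ltW.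
apply: (@le_trans _ _ (\sum_(i < m) \sum_(j < m) 2 * (x `^ b * ln x))).
  apply: ler_sum => i _; apply: ler_sum => j _.
  rewrite mulrA ler_wpM2r ?(ltW L0) // mulr_natl mulr2n.
  by rewrite lerD // ler_powR // ltW.
by rewrite !sumr_const !card_ord -!mulrnA -mulr_natr !natrM; lra.
Qed.

Theorem proposition4p5 (R : realType) (L : choiceType) (Q : query)
    (F : features Q) (m : nat) (a : 'I_m -> vars Q -> nat)
    (c : nat) (hc : c = max_cat F a) (c_ge1 : (1 <= c)%N) :
  let faqwij (i j : 'I_m) : R := faqw R (cvars F (a i) :|: cvars F (a j))%SET in
  let mu : R := Num.min (rhostar R Q) c%:R in
  [/\ forall i j : 'I_m, faqwij i j <= fhtw R Q + c%:R - 1,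
      forall (I : instance R L F) (i j : 'I_m),
        (sigma_size I (a i) (a j))%:R <= ((instance_size I)%:R : R) `^ mu &
      fhtw R Q + c%:R - 1 < rhostar R Q ->
      exists I : nat -> instance R L F,
        let N (n : nat) : R := (instance_size (I n))%:R in
        (N n @[n --> \oo] --> +oo) /\
        ((N n `^ rhostar R Q /
          \sum_(i < m) \sum_(j < m) (N n `^ faqwij i j + N n `^ mu) * ln (N n))
           @[n --> \oo] --> +oo)].
Proof.
move=> faqwij mu.
have card_le i j : (#|cvars F (a i) :|: cvars F (a j)| <= c)%N.
  rewrite hc; apply: leq_trans (leq_bigmax (F := fun i => \max_j
    #|cvars F (a i) :|: cvars F (a j)|) i).
  exact: (leq_bigmax (F := fun j => #|cvars F (a i) :|: cvars F (a j)|)).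
(* A maximum over an empty range is 0, so [c_ge1] provides a feature function and, likewise, a
   variable. *)
have m0 : (0 < m)%N.
  rewrite lt0n; apply: contraTneq c_ge1 => m0; rewrite -leqNgt hc.
  by apply/bigmax_leqP => i _; have := leq_trans (ltn_ord i) (eq_leq m0).
have V0 : (0 < #|vars Q|)%N.
  apply: leq_trans c_ge1 _; rewrite hc.
  by apply/bigmax_leqP => i _; apply/bigmax_leqP => j _; exact: max_card.
have /card_gt0P[v _] := V0.
have faqw_le i j : faqwij i j <= fhtw R Q + c%:R - 1.
  apply: le_trans (faqw_le_fhtw _ _) _; rewrite -addrA lerD2l lerBrDr natr1 ler_nat.
  (* For an empty union the truncated predecessor leaves [1 <= c]. *)
  by case: #|_| (card_le i j).
split=> // [I i j|lt_rho]; first exact: sigma_size_le_powR.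
exists (diag_instance R L F) => N.
have NE : N = fun n => n%:R by apply/funext => n; rewrite /N (diag_instance_size R L F v).
have Noo : N n @[n --> \oo] --> +oo by rewrite NE; exact: cvgr_idn.
split=> //; apply: (@powR_div_cvgy _ _ _ (m * m * 2)%:R _ _ lt_rho) => // [|n N1].
  by rewrite ltr0n !muln_gt0 m0.
apply: sum_powR_bounds => //.
(* The common exponent [fhtw + c - 1] also dominates [mu], through [c] and [fhtw >= 1]. *)
rewrite /mu; apply: (@le_trans _ _ c%:R); first by rewrite ge_min lexx orbT.
by rewrite addrAC lerDr subr_ge0; exact: (fhtw_ge1 R v).
Qed.
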